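(* The product $\mathbb{R} \times \omega$ has the Uniquely Universal property (UU). That is, there exists an open set $U \subseteq \mathbb{R} \times \omega$ such that for every open set $W \subseteq \omega$ there is exactly one $x \in \mathbb{R}$ with $U(x) = W$.
   Context: For topological spaces $X$ and $Y$, a set $A \subseteq X \times Y$ and $x \in X$, write $A(x) = \{y \in Y : (x,y) \in A\}$ for the cross section of $A$ at $x$. The product $X \times Y$ satisfies the Uniquely Universal property (UU) iff there exists an open set $U \subseteq X \times Y$ such that for every open set $W \subseteq Y$ there is a unique $x \in X$ with $U(x) = W$; such a $U$ is called a UU set for $X \times Y$. Here $\mathbb{R}$ carries its usual topology, $\omega = \{0,1,2,\dots\}$ carries the discrete topology (so every subset of $\omega$ is open), and $\mathbb{R} \times \omega$ carries the product topology. *)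

(* Defs.v *)
From mathcomp Require Import all_boot all_order all_algebra.
From mathcomp Require Import all_classical all_reals all_analysis.

Set Implicit Arguments.
Unset Strict Implicit.
Unset Printing Implicit Defensive.

Local Open Scope classical_set_scope.

Definition UU_set (X Y : topologicalType) (U : set (X * Y)) : Prop :=
  open U /\
  forall W : set Y, open W -> exists! x : X, xsection U x = W.

Definition uniquely_universal (X Y : topologicalType) : Prop :=
  exists U : set (X * Y), UU_set U.

(* Main.v *)
Require Import Defs.
From mathcomp Require Import all_boot all_order all_algebra.
From mathcomp Require Import all_classical all_reals all_analysis.
From mathcomp Require Import lra.
Import numFieldNormedType.Exports.

Import Order.TTheory GRing.Theory Num.Theory.
Local Open Scope classical_set_scope.

(** An open set [U] in [X * nat] is a sequence of open sets [U_n] in [X], and it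
has the uniquely universal property iff [x |-> {n | x in U_n}] is a bijection
from [X] to the subsets of [nat].

A first approximation comes from symbolic dynamics. Under the tent map of
[[0, 1]], let the itinerary of [x] be the set of times [n] at which the orbit of
[x] lies in the right half [(1/2, 1]]. Each condition is open because the orbit
is continuous in [x], and the itinerary determines [x] because the tent map
doubles distances on each half ([itinerary_inj]). Compactness of [[0, 1]] gives
a point for every infinite set ([itinerary_unbounded]). Some finite sets are not
itineraries, because the codings from the two sides of a preimage of [1/2]
compete for the same point; but a finite set with maximum [m > 0] that does not
contain [m - 1] always is one ([itinerary_isolated_top]).
Transporting [(0, 1)] to the whole line gives an injection [f] from the line to
the subsets of [nat].

The sets missed by [f] are then inserted as in Hilbert's hotel
([uniquely_universal_of_injection]). To a bounded set [A] attach the set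
[s A = A + {m}], where [m] lies above [A] and is chosen so that [s A] is a value
of [f]. Removing the maximum inverts [s], so [s] is injective on bounded sets.
For every missed [A], let the points with values [s A], [s (s A)], ... take the
values [A], [s A], ... instead. The modified map is a bijection. Each change
only removes the maximum of a value, and a given [n] is the maximum of only
finitely many sets; so each open set [U_n] loses only finitely many points and
stays open. *)

(** * Repairing an injection that misses only bounded sets *)

(** The bijection of Cantor, Schroeder and Bernstein: apply [s] on the orbits
under [s] of the points outside [V], and nothing elsewhere. The last clause of
the conclusion makes the bijection usable for topology: it moves a point only
by [s]. *)
Lemma injection_onto_subset (T : Type) (P V : set T) (s : T -> T) :
    (forall A, P A -> P (s A)) -> (forall A, P A -> V (s A)) ->
    (forall A B, P A -> P B -> s A = s B -> A = B) -> ~` V `<=` P ->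
  exists phi : T -> T, [/\ injective phi, range phi = V
    & forall A, phi A = A \/ (P A /\ phi A = s A)].
Proof.
move=> Ps Vs s_inj VP.
pose C A := exists i B, ~ V B /\ A = iter i s B.
have CP A : C A -> P A.
  by case=> i [B [VB ->]]; elim: i => [|i IH] /=; [exact: VP | exact: Ps].
have Cs A : C A -> C (s A).
  by case=> i [B [VB ->]]; exists i.+1, B.
exists (fun A => if pselect (C A) then s A else A); split.
- move=> A B; case: pselect => CA; case: pselect => CB //=.
  + by apply: s_inj; exact: CP.
  + by move=> e; case: CB; rewrite -e; exact: Cs.
  + by move=> e; case: CA; rewrite e; exact: Cs.
- apply/seteqP; split => [_ [A _ <-]|A VA] /=.
    case: pselect => [/CP/Vs//|CA] /=.
    by apply: contrapT => VA; apply: CA; exists 0, A.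
  have [[[|i] [B [VB eA]]]|CA] := pselect (C A); first by rewrite eA in VA.
    exists (iter i s B) => //; case: pselect => // -[]; by exists i, B.
  by exists A => //; case: pselect.
- by move=> A; case: pselect => CA; [right; split=> //; exact: CP|left].
Qed.

(** The adjoined element is the maximum, so it can be recognised and removed. *)
Lemma adjoin_top_inj {A B : set nat} {a b : nat} :
  A `<=` `I_a -> B `<=` `I_b -> A `|` [set a] = B `|` [set b] -> A = B.
Proof.
move=> Aa Bb e.
have ab : a = b.
  apply/eqP; rewrite eqn_leq; apply/andP; split.
    by have [/Bb/ltnW|->] : (B `|` [set b]) a by rewrite -e; right.
  by have [/Aa/ltnW|->] : (A `|` [set a]) b by rewrite e; right.
rewrite -{}ab in Bb e; apply/seteqP; split => k Xk.
  have [//|ka] : (B `|` [set a]) k by rewrite -e; left.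
  by move: (Aa _ Xk); rewrite /= ka ltnn.
have [//|ka] : (A `|` [set a]) k by rewrite e; left.
by move: (Bb _ Xk); rewrite /= ka ltnn.
Qed.

Lemma finite_bounded_subsets (n : nat) : finite_set [set A | A `<=` `I_n].
Proof.
pose g (S : {set 'I_n}) : set nat := [set k | exists2 i, i \in S & val i = k].
apply: (@sub_finite_set _ _ (g @` setT)); last first.
  by apply: finite_image; exact: finite_finset.
move=> A An; exists [set i : 'I_n | `[< A (val i) >]]%SET => //.
apply/seteqP; split => [k [i]|k Ak]; first by rewrite inE => /asboolP Ai <-.
by exists (Ordinal (An _ Ak)) => //; rewrite inE; apply/asboolP.
Qed.

Lemma open_discrete_prod (X : topologicalType) (U : set (X * nat)) :
  (forall n, open [set x | U (x, n)]) -> open U.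
Proof.
move=> Uo; rewrite openE => -[x n] Uxn.
exists ([set y | U (y, n)], [set n]) => /=.
  by split; [exact: open_nbhs_nbhs | exact: discrete_set1].
by move=> [y k] /= [Uyn ->].
Qed.

(** The reassigned value at [x] is the set [A] with [phi A = f x], where [phi]
adjoins to certain bounded sets a new maximum. Finite sets being closed in [X],
it is harmless to remove [n] from the values of finitely many points. *)
Lemma uniquely_universal_of_injection (X : topologicalType)
    (f : X -> set nat) :
    accessible_space X -> injective f -> (forall n, open [set x | f x n]) ->
    (forall A, (forall n, ~ A `<=` `I_n) -> range f A) ->
    (forall A n, A `<=` `I_n ->
       exists m, A `<=` `I_m /\ range f (A `|` [set m])) ->
  uniquely_universal X nat.
Proof.
move=> Xacc f_inj f_open f_unbounded f_bounded.
pose bounded A := exists n, A `<=` `I_n.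
have /choice[m mP] : forall A, exists m, bounded A ->
    A `<=` `I_m /\ range f (A `|` [set m]).
  move=> A; have [[n /f_bounded[m Am]]|nA] := pselect (bounded A).
    by exists m.
  by exists 0.
have [phi [phi_inj phi_range phiE]] : exists phi : set nat -> set nat,
    [/\ injective phi, range phi = range f & forall A,
       phi A = A \/ (bounded A /\ phi A = A `|` [set m A])].
  apply: injection_onto_subset.
  - move=> A /mP[Am _]; exists (m A).+1 => k [/Am/ltnW //|-> /=]; exact: ltnSn.
  - by move=> A /mP[].
  - move=> A B /mP[Am _] /mP[Bm _]; exact: adjoin_top_inj.
  - move=> A nA; apply: contrapT => bA; apply: nA; apply: f_unbounded => n An.
    by apply: bA; exists n.
have phi_ge A : A `<=` phi A by case: (phiE A) => [->|[_ ->]] // k Ak; left.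
exists [set xn | exists2 A, phi A = f xn.1 & A xn.2]; split.
  apply: open_discrete_prod => n /=.
  (* If [n] belongs to [f x = phi A] but not to [A], it is the maximum that
     [phi] adjoins, so [A] lies below [n]: the points where [n] is lost are
     among the finitely many points of [F]. *)
  pose F := [set x | exists2 A, A `<=` `I_n & f x = phi A].
  have Ffin : finite_set F.
    apply: (@sub_finite_set _ _ (f @^-1` (phi @` [set A | A `<=` `I_n]))).
      by move=> x [A An e]; exists A.
    apply: finite_preimage; first by move=> x y _ _; exact: f_inj.
    by apply: finite_image; exact: finite_bounded_subsets.
  rewrite [X in open X](_ : _ = [set x | f x n] `&` ~` F).
    apply: openI; first exact: f_open.
    by rewrite openC; exact: (accessible_finite_set_closed.1 Xacc).
  apply/seteqP; split => x /=.
    move=> [A e An]; split; first by rewrite -e; exact: phi_ge.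
    case=> B Bn; rewrite -e => /phi_inj eAB; rewrite -eAB in Bn.
    by have := Bn n An; rewrite /= ltnn.
  move=> [fxn nF].
  have [A _ e] : range phi (f x) by rewrite phi_range; exists x.
  exists A => //; case: (phiE A) => [<-|[/mP[Am _] eA]]; first by rewrite e.
  move: fxn; rewrite -e eA => -[//|/= nm].
  by case: nF; exists A; rewrite ?nm // e.
move=> W _; have [x _ xW] : range f (phi W) by rewrite -phi_range; exists W.
have sec A y : phi A = f y ->
    xsection [set xn | exists2 B, phi B = f xn.1 & B xn.2] y = A.
  move=> e; apply/seteqP; split => k; rewrite /xsection /= inE /=.
    by case=> B; rewrite -e => /phi_inj ->.
  by move=> Ak; exists A.
exists x; split; first exact: sec.
move=> y; have [A _ e] : range phi (f y) by rewrite phi_range; exists y.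
by rewrite (sec _ _ e) => AW; apply: f_inj; rewrite xW -e AW.
Qed.

(** * Itineraries of the tent map *)

Local Open Scope ring_scope.

Definition tent {R : realType} (x : R) : R := 1 - `|2 * x - 1|.

Definition itinerary {R : realType} (x : R) : set nat :=
  [set n | 2^-1 < iter n tent x].

Lemma tent_le {R : realType} (x : R) : x <= 2^-1 -> tent x = 2 * x.
Proof. by move=> ?; rewrite /tent ler0_norm; lra. Qed.

Lemma tent_ge {R : realType} (x : R) : 2^-1 <= x -> tent x = 2 - 2 * x.
Proof. by move=> ?; rewrite /tent ger0_norm; lra. Qed.

Lemma tent_itvcc {R : realType} (x : R) : 0 <= x <= 1 -> 0 <= tent x <= 1.
Proof.
move=> x01; case: (leP x 2^-1) => [x_le|/ltW x_ge].
  by rewrite tent_le; lra.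
by rewrite tent_ge; lra.
Qed.

Lemma iter_tent_itvcc {R : realType} {x : R} n :
  0 <= x <= 1 -> 0 <= iter n tent x <= 1.
Proof. by move=> x01; elim: n => //= n; exact: tent_itvcc. Qed.

Lemma iter_tent0 (R : realType) n : iter n tent (0 : R) = 0.
Proof. by elim: n => //= n ->; rewrite tent_le; lra. Qed.

Lemma continuous_iter_tent {R : realType} n : continuous (iter n (@tent R)).
Proof.
elim: n => [|n IH] x /=; first exact: cvg_id.
apply: cvgB; first exact: cvg_cst.
apply: cvg_norm; apply: cvgB; last exact: cvg_cst.
by apply: cvgM; [exact: cvg_cst | exact: IH].
Qed.

(** Two points with the same itinerary are always on the same side of [1/2], so
each step doubles their distance, which nevertheless stays at most [1]. *)
Lemma itinerary_inj {R : realType} :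
  {in [set x : R | 0 <= x <= 1] &, injective itinerary}.
Proof.
move=> x y; rewrite !inE /= => x01 y01 exy.
have expand n : `|iter n tent x - iter n tent y| = 2 ^+ n * `|x - y|.
  elim: n => [|n IH]; first by rewrite expr0 mul1r.
  have e2 (u v : R) : `|2 * u - 2 * v| = 2 * `|u - v|.
    by rewrite -mulrBr normrM ger0_norm.
  rewrite exprS -mulrA -IH /=.
  have side : (2^-1 < iter n tent x) = (2^-1 < iter n tent y).
    by apply/idP/idP; [rewrite -[is_true _]/(itinerary x n) exy
                      |rewrite -[is_true _]/(itinerary y n) -exy].
  case: (ltP 2^-1 (iter n tent x)) side => xn /esym yn.
    (* The right branch reverses orientation. *)
    rewrite !tent_ge ?ltW// -e2 distrC; congr `|_|; lra.
  by rewrite !tent_le ?e2// leNgt yn.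
apply/eqP; rewrite -subr_eq0 -normr_eq0; apply/eqP/le_anti/andP; split=> //.
rewrite leNgt; apply/negP => xy0.
have bound n : n%:R * `|x - y| <= 1.
  apply: (@le_trans _ _ (2 ^+ n * `|x - y|)).
    by rewrite ler_wpM2r// -natrX ler_nat ltnW// ltn_expl.
  rewrite -expand.
  have := iter_tent_itvcc n x01; have := iter_tent_itvcc n y01.
  by rewrite ler_norml; lra.
have := bound (Num.bound (`|x - y|^-1)).
rewrite leNgt => /negP; apply.
by rewrite -ltr_pdivrMr// div1r archi_boundP// invr_ge0.
Qed.

Lemma tent_preimage {R : realType} (b : Prop) {y : R} : 0 < y < 1 ->
  exists x : R, [/\ 0 < x < 1, tent x = y & 2^-1 < x <-> b].
Proof.
move=> y01; have [hb|hb] := pselect b.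
  exists (1 - y / 2); split; [lra| |by split => // _; lra].
  by rewrite tent_ge; lra.
exists (y / 2); split; [lra| |by split => // h; exfalso; lra].
by rewrite tent_le; lra.
Qed.

(** Each branch of the tent map sends an open half of [(0, 1)] onto [(0, 1)], so
any finite itinerary can be followed backwards from any end point. *)
Lemma itinerary_prefix {R : realType} (W : set nat) n {y : R} : 0 < y < 1 ->
  exists x : R, [/\ 0 < x < 1, iter n tent x = y
    & forall k, (k < n)%N -> itinerary x k <-> W k].
Proof.
move=> y01; elim: n W => [|n IH] W; first by exists y.
have [z [z01 zy zW]] := IH (fun k => W k.+1).
have [x [x01 xz xW]] := tent_preimage (W 0%N) z01.
exists x; split=> //; first by rewrite iterSr xz.
by case=> [_ //|k kn]; rewrite /itinerary /= -iterS iterSr xz; exact: zW.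
Qed.

(** The orbit [1/2, 1, 0, 0, ...] is in the right half at time [1] only; hence
[1/2] has the itinerary [{1}], and a point that reaches [1/2] after [n] steps
has the maximum [n + 1] in its itinerary. *)
Lemma itinerary_isolated_top (R : realType) (A : set nat) n : A `<=` `I_n ->
  exists x : R, 0 < x < 1 /\ itinerary x = A `|` [set n.+1].
Proof.
move=> An; have half01 : 0 < (2^-1 : R) < 1 by lra.
have [x [x01 xn xA]] := itinerary_prefix A n half01.
exists x; split=> //.
have xk k : iter (k + n) tent x = iter k tent 2^-1 by rewrite iterD xn.
have T1 : tent (2^-1 : R) = 1 by rewrite tent_le; lra.
have T2 : tent (1 : R) = 0 by rewrite tent_ge; lra.
apply/seteqP; split => k.
  have [kn /(xA _ kn)|nk] := ltnP k n; first by left.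
  rewrite /itinerary /= -(subnK nk) xk.
  case: (k - n)%N => [|[|j]]; first by rewrite ltxx.
    by right; rewrite add1n.
  by rewrite !iterSr T1 T2 iter_tent0 => h; exfalso; lra.
case=> [Ak|->]; first by apply/xA => //; exact: An.
by rewrite /itinerary /= xn T1; lra.
Qed.

(** Take a cluster point of points that follow [A] for longer and longer. In the
limit, each time only fixes a closed half. This ambiguity is resolved because an
orbit through [1/2] or an end point of [[0, 1]] is eventually [0], whereas an
infinite [A] brings the orbit back to the right half. *)
Lemma itinerary_unbounded (R : realType) (A : set nat) :
    (forall n, ~ A `<=` `I_n) ->
  exists x : R, 0 < x < 1 /\ itinerary x = A.
Proof.
move=> A_unbounded; have half01 : 0 < (2^-1 : R) < 1 by lra.
have /choice[z zP] n := itinerary_prefix A n half01.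
have [x [x01 xz]] : (`[(0 : R), 1] `&` cluster (z @ \oo)) !=set0.
  apply: segment_compact; exists 0%N => // n _ /=; rewrite in_itv /=.
  by have [/andP[/ltW-> /ltW->]] := zP n.
rewrite /= in_itv /= in x01.
have limit_in (K : set R) k : closed K ->
    (forall n, (k < n)%N -> K (iter k tent (z n))) -> K (iter k tent x).
  move=> Kcl Kz; apply: (@preimage_closed _ _ (iter k tent) K) => //.
    by move=> t _; exact: continuous_iter_tent.
  by move=> B xB; apply: xz => //; exists k.+1 => // n; exact: Kz.
have xA k : A k -> 2^-1 <= iter k tent x.
  move=> Ak; apply: (limit_in [set t | 2^-1 <= t]) => [|n kn].
    exact: closed_ge.
  by have [_ _ /(_ _ kn)[_ /(_ Ak)/ltW]] := zP n.
have xnA k : ~ A k -> iter k tent x <= 2^-1.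
  move=> nAk; apply: (limit_in [set t | t <= 2^-1]) => [|n kn].
    exact: closed_le.
  rewrite /= leNgt; apply/negP => h; apply: nAk.
  by have [_ _ /(_ _ kn)[+ _]] := zP n; exact.
have xN0 k : iter k tent x <> 0.
  move=> xk0; apply: (A_unbounded k) => j Aj /=.
  rewrite ltnNge; apply/negP => kj.
  by have := xA _ Aj; rewrite -(subnK kj) iterD xk0 iter_tent0; lra.
have T2 : tent (1 : R) = 0 by rewrite tent_ge; lra.
have xNhalf k : iter k tent x <> 2^-1.
  move=> xk; apply: (xN0 k.+2); rewrite /= xk.
  by rewrite [tent 2^-1]tent_le// mulfV// T2.
exists x; split.
  rewrite !lt_neqAle; have /andP[-> ->] := x01; rewrite !andbT.
  apply/andP; split; apply/eqP => e; first by apply: (xN0 0%N); rewrite -e.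
  by apply: (xN0 1%N); rewrite /= e.
apply/seteqP; split => k; rewrite /itinerary /=.
  by move=> h; apply: contrapT => /xnA; rewrite leNgt h.
by move=> /xA; rewrite le_eqVlt => /orP[/eqP/esym/xNhalf|].
Qed.

(** * The real line *)

Lemma injection_onto_unit_itv (R : realType) : exists g : R -> R,
  [/\ continuous g, injective g, forall x, 0 < g x < 1
    & forall y, 0 < y < 1 -> range g y].
Proof.
have pi0 := pi_gt0 R.
exists (fun x => atan x / pi + 2^-1); split.
- move=> x; apply: cvgD; last exact: cvg_cst.
  by apply: cvgM; [exact: continuous_atan | exact: cvg_cst].
- move=> x y /addIr /(mulIf (invr_neq0 (lt0r_neq0 pi0))).
  exact: (can_inj (@atanK R)).
- move=> x; have := atan_gtNpi2 x; have := atan_ltpi2 x => lt_pi2 gt_Npi2.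
  have : - 2^-1 < atan x / pi by rewrite ltr_pdivlMr//; lra.
  have : atan x / pi < 2^-1 by rewrite ltr_pdivrMr//; lra.
  lra.
- move=> y y01; exists (tan ((y - 2^-1) * pi)) => //.
  rewrite tanK; last by rewrite in_itv /=; nra.
  by rewrite mulfK ?lt0r_neq0// subrK.
Qed.

Theorem theorem4 (R : realType) : uniquely_universal R nat.
Proof.
have [g [g_cont g_inj g01 g_onto]] := injection_onto_unit_itv R.
apply: (@uniquely_universal_of_injection _ (itinerary \o g)).
- by apply: hausdorff_accessible; exact: order_hausdorff.
- have g01_le x : g x \in [set t : R | 0 <= t <= 1].
    by rewrite inE /=; have /andP[/ltW-> /ltW->] := g01 x.
  by move=> x y /= /(itinerary_inj _ _ (g01_le x) (g01_le y)); exact: g_inj.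
- move=> n; apply: (@open_comp _ _ (iter n tent \o g) [set t | 2^-1 < t]).
    move=> x _; apply: continuous_comp; first exact: g_cont.
    exact: continuous_iter_tent.
  exact: open_gt.
- move=> A /(itinerary_unbounded R)[y [/g_onto[x _ <-] <-]].
  by exists x.
- move=> A n An; exists n.+1; split; first by move=> k /An /ltnW.
  by have [y [/g_onto[x _ <-] <-]] := itinerary_isolated_top R A n An; exists x.
Qed.
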